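(* Let $\widetilde{V}:(\mathbb{Y},\|\cdot\|_\sigma)\to(\mathbb{Y},\|\cdot\|_{\mathbb{Y}})$ be a $\sigma$-shift operator with generating subspace $\mathcal{I}$. If $(\mathbb{Y},\|\cdot\|_\sigma)=(\mathbb{Y},\|\cdot\|_{\mathbb{Y}})$ and if it is a Hilbert space, then $\widetilde{V}$ is a bilateral shift with generating subspace $\mathcal{I}$.
   Context: All spaces are complex. $x\perp_B y$ in a normed space means $\|x+\lambda y\|\ge\|x\|$ for all $\lambda\in\mathbb{C}$; for subspaces it is required for all pairs of elements. $\sigma$-shift. Let $\mathbb{Y}$ be a vector space with two norms $\|\cdot\|_{\mathbb{Y}},\|\cdot\|_\sigma$, each making $\mathbb{Y}$ a Banach space. A surjective linear isometry $\widetilde{V}:(\mathbb{Y},\|\cdot\|_\sigma)\to(\mathbb{Y},\|\cdot\|_{\mathbb{Y}})$ is a $\sigma$-shift with generating subspace $\mathcal{I}$ if: (i) $\mathcal{I}$ is a linear subspace of $\mathbb{Y}$, closed in both norms, such that $\widetilde{V}^n\mathcal{I}\perp_B\mathcal{I}$ for $n=1,2,\dots$ (with respect to $\|\cdot\|_{\mathbb{Y}}$) and $\mathcal{I}\perp_B\widetilde{V}^n\mathcal{I}$ for $n=-1,-2,\dots$ (with respect to $\|\cdot\|_\sigma$); (ii) $(\mathbb{Y},\|\cdot\|_{\mathbb{Y}})=(\mathbb{W},\|\cdot\|_{\mathbb{W}})$, where $\mathbb{W}=\{w_1+w_2: w_1\in\bigoplus_{n=0}^\infty\widetilde{V}^n\mathcal{I},\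 w_2\in\bigoplus_{n=-\infty}^{-1}\widetilde{V}^n\mathcal{I}\}$ and $\|w_1+w_2\|_{\mathbb{W}}=(\|w_1\|_{\mathbb{Y}}^2+\|w_2\|_{\mathbb{Y}}^2)^{1/2}$. Here $\bigoplus_{n=0}^\infty\widetilde{V}^n\mathcal{I}$ (resp. $\bigoplus_{n=-\infty}^{-1}\widetilde{V}^n\mathcal{I}$) is the set of elements uniquely expressible as a series $\sum_{n=0}^\infty\widetilde{V}^nl_n$ (resp. $\sum_{n=1}^\infty\widetilde{V}^{-n}l_{-n}$), $l_n\in\mathcal{I}$, convergent in $\|\cdot\|_{\mathbb{Y}}$. Bilateral shift on a Hilbert space $\mathcal{H}$: a unitary $U$ for which there is a subspace $\mathcal{L}$ (a generating subspace) with $U^n\mathcal{L}\perp\mathcal{L}$ for all $n\in\mathbb{Z}\setminus\{0\}$ and $\bigoplus_{n=-\infty}^\infty U^n\mathcal{L}=\mathcal{H}$ (orthogonal direct sum). *)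

(* Defs.v *)
From HB Require Import structures.
From mathcomp Require Import all_boot all_order all_algebra complex finmap.
From mathcomp Require Import all_classical all_reals all_analysis.
From mathcomp Require Import summability.
Set Implicit Arguments. Unset Strict Implicit. Unset Printing Implicit Defensive.
Import Order.TTheory GRing.Theory Num.Theory.
Import numFieldNormedType.Exports.
Local Open Scope classical_set_scope.
Local Open Scope ring_scope.
Local Open Scope complex_scope.

Section Norms.
Context {R : realType} {Y : lmodType R[i]}.
Implicit Types (N : Y -> R) (A B : set Y).

(* Norms are functions rather than canonical structures, because one vector
   space has to carry two of them. *)
Record is_norm N : Prop := {
  norm_ge0 : forall x, 0 <= N x;
  norm_eq0 : forall x, N x = 0 -> x = 0;
  norm_scale : forall (a : R[i]) x, (N (a *: x))%:C = `|a| * (N x)%:C;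
  norm_triangle : forall x y, N (x + y) <= N x + N y }.

Definition cvg_wrt N {T : Type} (F : set_system T) (f : T -> Y) (y : Y) : Prop :=
  N (f t - y) @[t --> F] --> (0 : R).

Definition cauchy_wrt N (u : nat -> Y) : Prop :=
  forall e : R, 0 < e ->
    exists n0, forall m n, (n0 <= m)%N -> (n0 <= n)%N -> N (u m - u n) < e.

Definition is_banach_norm N : Prop :=
  is_norm N /\
  forall u : nat -> Y, cauchy_wrt N u -> exists y, cvg_wrt N \oo u y.

Definition closed_wrt N A : Prop :=
  forall (u : nat -> Y) y, (forall n, A (u n)) -> cvg_wrt N \oo u y -> A y.

Definition birkhoff_orthogonal N (x y : Y) : Prop :=
  forall l : R[i], N x <= N (x + l *: y).

Definition birkhoff_orthogonal_sets N A B : Prop :=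
  forall x y, A x -> B y -> birkhoff_orthogonal N x y.

(* [pinv_ (fun=> 0) setT V] is the two-sided inverse of [V] whenever [V] is
   bijective; the default value is then never used. *)
Definition iterz (V : Y -> Y) (n : int) : Y -> Y :=
  match n with
  | Posz k => iter k V
  | Negz k => iter k.+1 (pinv_ (fun=> 0) [set: Y] V)
  end.

(* Elements having exactly one expansion [\sum_(n >= 0) T n (l n)] that
   converges for [N] and has all its coefficients [l n] in [A]. *)
Definition unique_series_sum N (T : nat -> Y -> Y) A : set Y :=
  [set y | exists! l : nat -> Y, (forall n, A (l n)) /\
     cvg_wrt N \oo (fun k => \sum_(0 <= n < k) T n (l n)) y].

Definition forward_sum N (V : Y -> Y) A : set Y :=
  unique_series_sum N (fun n => iterz V n%:Z) A.

(* The coefficient written [l_{-n}] in the usual indexing by n >= 1 is here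
   [l n.-1]: leaving an unused index 0 would destroy uniqueness. *)
Definition backward_sum N (V : Y -> Y) A : set Y :=
  unique_series_sum N (fun n => iterz V (- n.+1%:Z)) A.

Record sigma_shift (Nsigma NY : Y -> R) (V : {linear Y -> Y}) (A : set Y)
    : Prop := {
  sigma_shift_banach_sigma : is_banach_norm Nsigma;
  sigma_shift_banach : is_banach_norm NY;
  sigma_shift_surjective : forall y, exists x, V x = y;
  sigma_shift_isometry : forall x, NY (V x) = Nsigma x;
  sigma_shift_subspace : submod_closed [in A];
  sigma_shift_closed_sigma : closed_wrt Nsigma A;
  sigma_shift_closed : closed_wrt NY A;
  sigma_shift_forward_orthogonal : forall n : int, 0 < n ->
    birkhoff_orthogonal_sets NY (iterz V n @` A) A;
  sigma_shift_backward_orthogonal : forall n : int, n < 0 ->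
    birkhoff_orthogonal_sets Nsigma A (iterz V n @` A);
  sigma_shift_space :
    [set: Y] = [set w1 + w2 | w1 in forward_sum NY V A
                            & w2 in backward_sum NY V A];
  sigma_shift_norm : forall w1 w2,
    forward_sum NY V A w1 -> backward_sum NY V A w2 ->
    NY (w1 + w2) = Num.sqrt (NY w1 ^+ 2 + NY w2 ^+ 2) }.

End Norms.

Section Hilbert.
Context {R : realType} {Y : lmodType R[i]}.
Variable dot : {dot Y for (@Num.conj R[i])}.

Definition hilbert_norm (y : Y) : R := Num.sqrt (complex.Re (dot y y)).

Definition orthogonal_sets (A B : set Y) : Prop :=
  forall x y, A x -> B y -> dot x y = 0.

(* [Y] is the orthogonal direct sum of the [M n], [n] in [int]: the series are
   unconditionally convergent, i.e. along the net of finite subsets. *)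
Definition is_orthogonal_sum (M : int -> set Y) : Prop :=
  (forall m n, m != n -> orthogonal_sets (M m) (M n)) /\
  forall y, exists x : int -> Y, (forall n, M n (x n)) /\
    cvg_wrt hilbert_norm totally
      (fun F : {fset int} => \sum_(n <- F) x n) y.

Record unitary (U : {linear Y -> Y}) : Prop := {
  unitary_surjective : forall y, exists x, U x = y;
  unitary_dot : forall x y, dot (U x) (U y) = dot x y }.

Record bilateral_shift (U : {linear Y -> Y}) (L : set Y) : Prop := {
  bilateral_shift_unitary : unitary U;
  bilateral_shift_subspace : submod_closed [in L];
  bilateral_shift_closed : closed_wrt hilbert_norm L;
  bilateral_shift_orthogonal : forall n : int, n != 0 ->
    orthogonal_sets (iterz U n @` L) L;
  bilateral_shift_sum : is_orthogonal_sum (fun n => iterz U n @` L) }.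

End Hilbert.

(* Main.v *)
(* In a Hilbert space Birkhoff orthogonality is orthogonality, and a linear
   isometry preserves the inner product by polarization; hence [V] is unitary
   and the subspaces [V^n I], [n] in [int], are pairwise orthogonal.  Adding the
   forward and backward expansions of [y] gives an expansion along the symmetric
   windows [-k <= n < k], and orthogonality makes it unconditional. *)
Require Import Defs.
From mathcomp Require Import all_boot all_order all_algebra complex finmap.
From mathcomp Require Import all_classical all_reals all_analysis.
From mathcomp Require Import summability ring lra zify.
Import Order.TTheory GRing.Theory Num.Theory.
Import numFieldNormedType.Exports.
Local Open Scope classical_set_scope.
Local Open Scope ring_scope.

(** * Inner products: Birkhoff orthogonality, isometries, Pythagoras *)

Section InnerProduct.
Context {R : realType} {Y : lmodType R[i]}.
Variable dot : {dot Y for (@Num.conj R[i])}.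

Lemma hilbert_norm_sqr (y : Y) : ((hilbert_norm dot y) ^+ 2)%:C%C = dot y y.
Proof.
have dot0 : 0 <= dot y y := dnorm_ge0 dot y.
rewrite sqr_sqrtr ?RRe_real ?ger0_real //.
by move: dot0; rewrite lecE => /andP[].
Qed.

Lemma le_hilbert_norm (x y : Y) :
  (hilbert_norm dot x <= hilbert_norm dot y) = (dot x x <= dot y y).
Proof.
by rewrite -!hilbert_norm_sqr lecR ler_sqr // nnegrE sqrtr_ge0.
Qed.

(** The scalar [- (dot x y / dot y y)] turns [x + l *: y] into the residual of projecting [x] on
    [y]. Its squared norm is [dot x x] minus [|dot x y|^2 / dot y y], which is at least [dot x x]
    only if [dot x y = 0]. *)
Lemma birkhoff_orthogonal_dot (x y : Y) :
  birkhoff_orthogonal (hilbert_norm dot) x y -> dot x y = 0.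
Proof.
have [->|y_neq0] := eqVneq y 0; first by rewrite linear0r.
move=> /(_ (- (dot x y / dot y y))).
have yy_gt0 : 0 < dot y y := neq0_dnorm_gt0 y y_neq0.
rewrite le_hilbert_norm scaleNr dnormB dnormZ linearZr_LR /=.
rewrite rmorphM /= fmorphV /= (CrealP (gtr0_real yy_gt0)).
set d := dot x y; set q := dot y y in yy_gt0 *.
rewrite rmorphM /= rmorphM /= fmorphV /= conjCK (CrealP (gtr0_real yy_gt0)).
rewrite normf_div (gtr0_norm yy_gt0) exprMn exprVn normCK => le_norm.
have : d * d^* / q <= 0.
  rewrite -(lerD2l (dot x x)) addr0 -lerBrDr; apply: le_trans le_norm _.
  rewrite le_eqVlt; apply/orP; left; apply/eqP; field.
  by rewrite gt_eqF.
rewrite -normCK pmulr_lle0 ?invr_gt0 // real_exprn_even_le0 ?normr_real //=.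
by rewrite normr_eq0 => /eqP.
Qed.

Lemma isometry_dot (U : {linear Y -> Y}) :
  (forall x, hilbert_norm dot (U x) = hilbert_norm dot x) ->
  forall x y, dot (U x) (U y) = dot x y.
Proof.
move=> isoU x y.
have normU z : dot (U z) (U z) = dot z z by rewrite -!hilbert_norm_sqr isoU.
(* Expanding the squared norm of [x + z] and of its image compares the real parts. *)
have polar z : dot (U x) (U z) + (dot (U x) (U z))^* = dot x z + (dot x z)^*.
  have := normU (x + z).
  by rewrite linearD !dnormD !normU => /addrI.
(* As [dot] is conjugate-linear on the right, this choice gives the imaginary parts. *)
have := polar ('i *: y).
rewrite linearZ !linearZr_LR /=.
have := polar y.
move: (dot (U x) (U y)) (dot x y) => d d' re.
rewrite !rmorphM /= conjCK conjCi !mulNr => im.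
have {}im : d^* - d = d'^* - d'.
  apply: (mulfI (neq0Ci R[i])).
  by rewrite !mulrBr addrC im addrC.
have {}im : d - d^* = d' - d'^* by rewrite -[LHS]opprB im opprB.
apply: (mulIf (x := 2)); first by rewrite pnatr_eq0.
have dbl (z : R[i]) : z * 2 = (z + z^*) + (z - z^*).
  by rewrite addrACA subrr addr0 mulr_natr.
by rewrite !dbl re im.
Qed.

Lemma dot_sum_orthogonal (J : eqType) (x : J -> Y) (s : seq J) (P : pred J) :
  uniq s -> (forall i j, i != j -> dot (x i) (x j) = 0) ->
  dot (\sum_(i <- s | P i) x i) (\sum_(i <- s | P i) x i) =
  \sum_(i <- s | P i) dot (x i) (x i).
Proof.
move=> + orth; elim: s => [|i s IHs] /=; first by rewrite !big_nil linear0r.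
move=> /andP[i_notin_s uniq_s]; rewrite !big_cons; case: (P i); last exact: IHs.
have orth_i : dot (x i) (\sum_(j <- s | P j) x j) = 0.
  rewrite linear_sumr big_seq_cond big1 // => j /andP[j_in_s _].
  by apply: orth; apply: contraNneq i_notin_s => ->.
by rewrite (hnormDd orth_i); congr (_ + _); exact: IHs.
Qed.

(** By Pythagoras the squared norm is a sum of nonnegative terms, and a larger index set only adds
    terms. *)
Lemma hilbert_norm_sum_orthogonal_le (J : eqType) (x : J -> Y) (s : seq J)
    (P Q : pred J) :
  uniq s -> (forall i j, i != j -> dot (x i) (x j) = 0) ->
  subpred P Q ->
  hilbert_norm dot (\sum_(i <- s | P i) x i) <=
  hilbert_norm dot (\sum_(i <- s | Q i) x i).
Proof.
move=> uniq_s orth PQ; rewrite le_hilbert_norm !dot_sum_orthogonal //.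
rewrite big_mkcond [leRHS]big_mkcond; apply: ler_sum => i _.
by have := PQ i; case: (P i) => [->//|_]; case: (Q i).
Qed.

End InnerProduct.

(** * Convergence with respect to a norm *)

Section Convergence.
Context {R : realType} {Y : lmodType R[i]}.
Variable N : Y -> R.
Hypothesis N_norm : is_norm N.

Lemma is_norm_subC (x y : Y) : N (x - y) = N (y - x).
Proof.
apply: complexI; have := norm_scale N_norm (-1) (x - y).
by rewrite scaleN1r opprB normrN1 mul1r => ->.
Qed.

Lemma cvg_wrtP {T : Type} (F : set_system T) (FF : Filter F) (f : T -> Y) y :
  cvg_wrt N F f y <->
  forall e : R, 0 < e -> \forall t \near F, N (f t - y) < e.
Proof.
split=> [/cvgr0Pnorm_lt cvgf e e_gt0|cvgf].
  by apply: filterS (cvgf e e_gt0) => t; rewrite ger0_norm ?(norm_ge0 N_norm).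
apply/cvgr0Pnorm_lt => e e_gt0.
by apply: filterS (cvgf e e_gt0) => t; rewrite ger0_norm ?(norm_ge0 N_norm).
Qed.

Lemma cvg_wrtD {T : Type} (F : set_system T) (FF : Filter F) (f g : T -> Y) a b :
  cvg_wrt N F f a -> cvg_wrt N F g b ->
  cvg_wrt N F (fun t => f t + g t) (a + b).
Proof.
move=> /cvg_wrtP cvgf /cvg_wrtP cvgg; apply/cvg_wrtP => e e_gt0.
have e2_gt0 : 0 < e / 2 by rewrite divr_gt0.
apply: filterS2 (cvgf _ e2_gt0) (cvgg _ e2_gt0) => t ft gt.
rewrite opprD addrACA; apply: le_lt_trans (norm_triangle N_norm _ _) _.
by rewrite [ltRHS]splitr ltrD.
Qed.

End Convergence.

(** * Symmetric windows exhausting the integers *)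

Section Windows.

(* The integers [n] with [- k <= n < k]: [Negz m] is [- m.+1]. *)
Definition window (k : nat) : seq int :=
  map Posz (iota 0 k) ++ map Negz (iota 0 k).

Lemma window_uniq k : uniq (window k).
Proof.
rewrite cat_uniq !map_inj_uniq ?iota_uniq //=; try by move=> ? ? [].
by rewrite andbT; apply/hasPn => _ /mapP[n _ ->]; apply/mapP => -[].
Qed.

Lemma mem_window k (n : int) :
  (n \in window k) = match n with Posz m => m < k | Negz m => m < k end%N.
Proof.
rewrite mem_cat; case: n => m.
  rewrite mem_map ?mem_iota ?add0n /=; last by move=> ? ? [].
  by rewrite [X in _ || X](_ : _ = false) ?orbF //; apply/mapP => -[].
rewrite [X in X || _](_ : _ = false) /=; last by apply/mapP => -[].
by rewrite mem_map ?mem_iota ?add0n //; move=> ? ? [].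
Qed.

Lemma window_exhaust (s : seq int) (k : nat) :
  exists2 m, (k <= m)%N & {subset s <= window m}.
Proof.
elim: s => [|n s [m km sub]]; first by exists k.
(* Windows are open on the right, so a nonnegative [n] needs the successor. *)
exists (maxn m `|n|%N.+1); first by rewrite leq_max km.
move=> i; rewrite inE => /orP[/eqP ->|/sub]; rewrite !mem_window.
  by case: n => n; lia.
by case: i => i; lia.
Qed.

(** Splits a window sum into the [k]-th partial sums of a forward and a backward series. *)
Lemma big_window (V : zmodType) (x : int -> V) k :
  \sum_(n <- window k) x n =
  \sum_(0 <= n < k) x (Posz n) + \sum_(0 <= n < k) x (Negz n).
Proof. by rewrite big_cat !big_map /index_iota subn0. Qed.

End Windows.

(** * Unconditional convergence of orthogonal series *)

Section OrthogonalSeries.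
Context {R : realType} {Y : lmodType R[i]}.
Variable dot : {dot Y for (@Num.conj R[i])}.
Hypothesis norm_dot : is_norm (hilbert_norm dot).

(* A finite set [F] containing [window k] lies in some [window m], and the
   partial sums over [F] and [window k] differ from the one over [window m] by
   orthogonal sums over complements: hence the error over [F] is controlled by
   those over the two windows. *)
Lemma orthogonal_window_cvg_totally (x : int -> Y) (y : Y) :
  (forall i j, i != j -> dot (x i) (x j) = 0) ->
  cvg_wrt (hilbert_norm dot) \oo (fun k => \sum_(n <- window k) x n) y ->
  cvg_wrt (hilbert_norm dot) totally
    (fun F : {fset int} => \sum_(n <- F) x n) y.
Proof.
move=> orth /(cvg_wrtP _ norm_dot) cvg_window.
have totallyF : ProperFilter totally := @totally_filter int.
apply/(cvg_wrtP _ norm_dot) => e e_gt0.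
(* Thirds, because the error over [F] is at most twice the error over [window m] plus the error over
   [window k]. *)
have e3_gt0 : 0 < e / 3 by rewrite divr_gt0.
have [k _ near_y] := cvg_window _ e3_gt0.
exists [fset n in window k]%fset => // F /= /fsubsetP kF.
have [m km Fm] := window_exhaust F k.
have sub_window (s : seq int) : uniq s -> {subset s <= window m} ->
    \sum_(n <- window m) x n - \sum_(n <- s) x n =
    \sum_(n <- window m | n \notin s) x n.
  move=> uniq_s s_sub.
  rewrite (bigID (fun n => n \in s)) /= -big_filter (perm_big s) /=.
    by rewrite addrC addrK.
  apply: uniq_perm => //; first by rewrite filter_uniq ?window_uniq.
  by move=> n; rewrite mem_filter andb_idr // => /s_sub.
have closer : hilbert_norm dot (\sum_(n <- window m) x n - \sum_(n <- F) x n) <=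
    hilbert_norm dot (\sum_(n <- window m) x n - \sum_(n <- window k) x n).
  have subkm : {subset window k <= window m}.
    by move=> n; rewrite !mem_window; case: n => n /leq_trans; apply.
  rewrite !sub_window ?window_uniq ?fset_uniq //.
  apply: hilbert_norm_sum_orthogonal_le => //; first exact: window_uniq.
  (* Since [F] contains [window k], an index outside [F] is outside [window k]. *)
  by move=> n /=; apply: contra => nk; apply: kF; rewrite in_fset.
have tri := norm_triangle norm_dot.
have /= yk := near_y k (leqnn k); have /= ym := near_y m km.
set sm := \sum_(n <- window m) x n in closer ym.
set sk := \sum_(n <- window k) x n in closer yk.
set sF := \sum_(n <- F) x n in closer *.
have tF := tri (sF - sm) (sm - y); have tk := tri (sm - y) (y - sk).
rewrite addrA subrK in tF; rewrite addrA subrK in tk.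
rewrite (is_norm_subC _ norm_dot sF sm) in tF.
rewrite (is_norm_subC _ norm_dot y) in tk.
lra.
Qed.

End OrthogonalSeries.

(** * Integer powers of a bijective linear map *)

Section Iterates.
Context {R : realType} {Y : lmodType R[i]}.
Variable V : {linear Y -> Y}.
Hypothesis V_inj : injective V.
Hypothesis V_surj : forall y, exists x, V x = y.

Lemma pinv_cancel : cancel (pinv_ (fun=> 0) [set: Y] V) V.
Proof.
move=> y; apply: pinvK; rewrite inE.
by have [x Vx] := V_surj y; exists x.
Qed.

Lemma iterzS (n : int) x : iterz V (n + 1) x = V (iterz V n x).
Proof.
case: n => n; first by rewrite -PoszD addn1.
case: n => [|n]; first by rewrite /= pinv_cancel.
have -> : Negz n.+1 + 1 = Negz n by lia.
by rewrite /= pinv_cancel.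
Qed.

Lemma iterzD (m n : int) x : iterz V (m + n) x = iterz V m (iterz V n x).
Proof.
elim/int_rect: m => [|m IHm|m IHm]; first by rewrite add0r.
  by rewrite -addn1 PoszD addrAC !iterzS IHm.
(* Applying [V] to both sides raises the exponents by one, back to the induction hypothesis. *)
apply: V_inj; rewrite -!iterzS addrAC -addn1 PoszD opprD subrK.
by rewrite IHm.
Qed.

Lemma iterz_dot (dot : {dot Y for (@Num.conj R[i])}) :
  (forall x y, dot (V x) (V y) = dot x y) ->
  forall n x y, dot (iterz V n x) (iterz V n y) = dot x y.
Proof.
move=> dotV n x y; elim/int_rect: n => [//|n IHn|n IHn].
  by rewrite -addn1 PoszD !iterzS dotV.
by rewrite -dotV -!iterzS -addn1 PoszD opprD subrK.
Qed.

End Iterates.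

Theorem proposition6p6 (R : realType) (Y : lmodType R[i])
    (normY normsigma : Y -> R) (V : {linear Y -> Y}) (I : set Y)
    (hV : sigma_shift normsigma normY V I)
    (hnorms : forall y : Y, normsigma y = normY y)
    (dot : {dot Y for (@Num.conj R[i])})
    (hdot : forall y : Y, normY y = hilbert_norm dot y) :
  bilateral_shift dot V I.
Proof.
have normsigmaE : normsigma = normY by apply/funext.
have normYE : normY = hilbert_norm dot by apply/funext.
subst normsigma normY => {hnorms hdot}.
have [_ [norm_dot _] V_surj V_iso I_sub _ I_closed fwd bwd space _] := hV.
have dotV := isometry_dot dot V V_iso.
have V_inj : injective V.
  move=> x y Vxy; apply/eqP; rewrite -subr_eq0 -(dnorm_eq0 dot) -dotV.
  by rewrite linearB Vxy subrr linear0r.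
have dot_iterz := iterz_dot V V_surj dot dotV.
have orth (n : int) : n != 0 -> orthogonal_sets dot (iterz V n @` I) I.
  rewrite neq_lt => /orP[n_lt0|n_gt0] x y Ix Iy; last first.
    exact: birkhoff_orthogonal_dot (fwd n n_gt0 x y Ix Iy).
  (* For negative [n] the Birkhoff hypothesis has [I] on the left; Hermitian symmetry swaps the
     sides. *)
  rewrite hermC /= (birkhoff_orthogonal_dot dot y x) ?rmorph0 ?mulr0 //.
  exact: bwd Iy Ix.
have orth2 (m n : int) : m != n ->
    orthogonal_sets dot (iterz V m @` I) (iterz V n @` I).
  move=> mn _ _ [a Ia <-] [b Ib <-].
  (* With [m = n + (m - n)], the common power [V^n] cancels in the inner product. *)
  rewrite -{1}(subrKC n m) (iterzD V V_inj V_surj) dot_iterz.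
  by apply: (orth (m - n)); [rewrite subr_eq0|exists a|].
split=> //; split=> // y.
have [w1 [a [[Ia cvga] _]] [w2 [b [[Ib cvgb] _]] <-]] :
    [set w1 + w2 | w1 in forward_sum (hilbert_norm dot) V I
                 & w2 in backward_sum (hilbert_norm dot) V I] y.
  by rewrite -space.
pose x (n : int) :=
  iterz V n match n with Posz k => a k | Negz k => b k end.
have Ix n : (iterz V n @` I) (x n).
  by case: n => k; [exists (a k)|exists (b k)].
exists x; split=> //.
apply: orthogonal_window_cvg_totally => //.
  by move=> i j ij; apply: orth2 ij _ _ (Ix i) (Ix j).
under eq_fun do rewrite big_window.
by apply: (cvg_wrtD _ norm_dot); [exact: cvga|exact: cvgb].
Qed.
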